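(* Let $d\ge 2$ be an integer, let $V=\{1,\dots,d\}$, and let $\Pi=(\pi_{ij})$ be a real $d\times d$ matrix such that: $\pi_{ii}=1$ for all $i\in V$; $\pi_{ij}>0$ for all $i,j\in V$; $\pi_{ij}\le \pi_{ik}\pi_{kj}$ for all $i,j,k\in V$; and there exist $i,j,k\in V$ with $\pi_{ij}<\pi_{ik}\pi_{kj}$. Let $K_d$ be the solvency cone induced by $\Pi$ and $K_d^+$ its dual cone. For $y\in\mathbb{R}^d$, the following statements are equivalent: (i) $y$ is an extreme direction of $K_d^+$; (ii) $y$ is a feasible tree solution with respect to some bipartition $(P,N)$ of $V$.
   Context: The solvency cone is $K_d=\{\sum_{(i,j)\in V\times V} z_{ij}(\pi_{ij}e^i-e^j) : z_{ij}\ge 0 \text{ for all } i,j\}$, where $e^i$ is the $i$-th unit vector of $\mathbb{R}^d$, and $K_d^+=\{y\in\mathbb{R}^d : x^\top y\ge 0 \text{ for all } x\in K_d\}$. A vector $y\in K\setminus\{0\}$ is an extreme direction of a polyhedral convex cone $K\subseteq\mathbb{R}^d$ if it cannot be expressed as the sum of two other directions of $K$, where directions that are positive multiples of each other are considered identical; equivalently, $y\ne0$ belongs to a $1$-dimensional face (edge) of $K$. A bipartition $(P,N)$ of $V$ is an ordered pair of nonempty disjoint sets with $P\cup N=V$. $G(P,N)$ is the bipartite digraph with node set $V$ and arc set $P\times N$. A spanning tree of a digraph is a connected subgraph with the full node set and without cycles, where arc directions are ignored for connectedness and cycles. A vector $y\in\mathbb{R}^d$ is generated by a tree $T$ if $T$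 is a spanning tree of $G(P,N)$ and $\pi_{ij}y_i=y_j>0$ for all arcs $(i,j)\in E(T)\subseteq P\times N$. A vector $y$ is feasible with respect to $(P,N)$ if $\pi_{ij}y_i\ge y_j>0$ for all $(i,j)\in P\times N$. A feasible tree solution with respect to $(P,N)$ is a vector $y\in\mathbb{R}^d$ that is both feasible with respect to $(P,N)$ and generated by some spanning tree $T$ of $G(P,N)$. *)

(* Defs.v *)
From mathcomp Require Import classical_sets reals.
From mathcomp Require Import all_boot all_order all_algebra.

Set Implicit Arguments.
Unset Strict Implicit.
Unset Printing Implicit Defensive.

Import Order.TTheory GRing.Theory Num.Theory.
Local Open Scope ring_scope.

(* Nodes and coordinates are indexed by 'I_d, i.e. V = {0, ..., d-1}. *)

Definition unit_vec (R : realType) (d : nat) (i : 'I_d) : 'cV[R]_d :=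
  delta_mx i 0.

Definition solvency_cone (R : realType) (d : nat) (Pi : 'M[R]_d) :
    set 'cV[R]_d :=
  [set x | exists z : 'M[R]_d,
     (forall i j, 0 <= z i j) /\
     x = \sum_(ij : 'I_d * 'I_d)
           z ij.1 ij.2 *: (Pi ij.1 ij.2 *: unit_vec R ij.1 - unit_vec R ij.2)
  ]%classic.

Definition dual_cone (R : realType) (d : nat) (K : set 'cV[R]_d) :
    set 'cV[R]_d :=
  [set y | forall x, K x -> 0 <= (x^T *m y) 0 0]%classic.

Definition same_direction (R : realType) (d : nat) (u v : 'cV[R]_d) : Prop :=
  exists2 c : R, 0 < c & u = c *: v.

Definition is_direction (R : realType) (d : nat) (K : set 'cV[R]_d)
    (y : 'cV[R]_d) : Prop :=
  K y /\ y <> 0.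

Definition extreme_direction (R : realType) (d : nat) (K : set 'cV[R]_d)
    (y : 'cV[R]_d) : Prop :=
  is_direction K y /\
  ~ (exists u v : 'cV[R]_d,
      [/\ is_direction K u, is_direction K v,
          ~ same_direction u y, ~ same_direction v y & y = u + v]).

Definition bipartition (d : nat) (P N : {set 'I_d}) : Prop :=
  [/\ P != set0, N != set0, [disjoint P & N] & P :|: N = [set: 'I_d]].

(* Adjacency of the undirected graph underlying the arc set E. *)
Definition adjacent (d : nat) (E : {set 'I_d * 'I_d}) : rel 'I_d :=
  fun u v => ((u, v) \in E) || ((v, u) \in E).

(* A spanning subgraph of G(P,N) is given by its arc set E, since its node set
   is all of V. For disjoint P and N, G(P,N) has neither loops nor antiparallel
   arcs, so its undirected cycles are the closed sequences of at least three
   distinct, consecutively adjacent nodes; the bound on the size is needed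
   because [:: u; v] is always a [ucycle] when u and v are adjacent. *)
Definition spanning_tree (d : nat) (P N : {set 'I_d})
    (E : {set 'I_d * 'I_d}) : Prop :=
  [/\ E \subset setX P N,
      forall u v : 'I_d, connect (adjacent E) u v
    & ~ (exists c : seq 'I_d, ucycle (adjacent E) c /\ (3 <= size c)%N)].

Definition generated_by (R : realType) (d : nat) (Pi : 'M[R]_d)
    (P N : {set 'I_d}) (E : {set 'I_d * 'I_d}) (y : 'cV[R]_d) : Prop :=
  spanning_tree P N E /\
  (forall i j : 'I_d, (i, j) \in E ->
     Pi i j * y i 0 = y j 0 /\ 0 < y j 0).

Definition feasible (R : realType) (d : nat) (Pi : 'M[R]_d)
    (P N : {set 'I_d}) (y : 'cV[R]_d) : Prop :=
  forall i j : 'I_d, i \in P -> j \in N ->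
    y j 0 <= Pi i j * y i 0 /\ 0 < y j 0.

Definition feasible_tree_solution (R : realType) (d : nat) (Pi : 'M[R]_d)
    (P N : {set 'I_d}) (y : 'cV[R]_d) : Prop :=
  feasible Pi P N y /\
  (exists E : {set 'I_d * 'I_d}, generated_by Pi P N E y).

(* Main.v *)
Require Import Defs.
From mathcomp Require Import classical_sets reals.
From mathcomp Require Import all_boot all_order all_algebra.
From mathcomp Require Import ring lra.

Import Order.TTheory GRing.Theory Num.Theory.
Local Open Scope ring_scope.

(** The dual cone is cut out by the finitely many inequalities
    [y j <= Pi i j * y i]. Multiplying them along a cycle on which the product
    of the exchange rates exceeds 1 (one exists by strictness) shows that its
    nonzero elements are strictly positive ([dual_gt0]). Hence the face on which
    a set of these inequalities is tight is governed by the graph of the tight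
    arcs: along a tight arc the ratio of two coordinates is prescribed, so [y]
    is extreme if and only if its tight arcs connect all the nodes. If they do,
    both summands in a decomposition of [y] inherit the tight arcs and are
    multiples of [y] ([tight_connected_extreme]); if they do not, [y] splits by
    rescaling one connected component slightly up or down
    ([extreme_tight_connected]).

    It remains to relate connected tight graphs to feasible tree solutions. By
    the triangle inequality the tight arcs form a preorder. Let [P] be its set
    of minimal nodes and [N] the rest. If the preorder is connected and not all
    arcs are tight, each node of [N] lies above a node of [P] and each node of
    [P] lies below a node of [N], so any arc inside [P] or inside [N] can be
    replaced by a detour of two arcs from [P] to [N]. The tight arcs from [P] to
    [N] thus already connect everything ([bipartite_connected]), and any
    inclusion-minimal connected set of them is a spanning tree
    ([spanning_tree_exists]).

    Conversely, the arcs of the tree of a feasible tree solution are tight, so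
    only membership in the dual cone is at stake, and feasibility provides just
    the inequalities from [P] to [N]. For an arbitrary pair [(i, j)], a tight
    arc leads to [i] from some [a] in [P] and from [j] to some [b] in [N]; the
    inequality for [(a, b)] and the triangle inequality along [a, i, j, b] give
    the one for [(i, j)] ([feasible_dual]). *)

(** * Connected graphs and spanning trees *)

Definition connected {d : nat} (E : {set 'I_d * 'I_d}) : bool :=
  [forall u, forall v, connect (adjacent E) u v].

Lemma connectedP {d : nat} {E : {set 'I_d * 'I_d}} :
  reflect (forall u v, connect (adjacent E) u v) (connected E).
Proof. by apply: (iffP forallP) => H u; apply/forallP/(H u). Qed.

Lemma adjacent_sym {d : nat} (E : {set 'I_d * 'I_d}) : symmetric (adjacent E).
Proof. by move=> u v; rewrite /adjacent orbC. Qed.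

Lemma connected_invariant {d : nat} {E : {set 'I_d * 'I_d}} {T : Type}
    (f : 'I_d -> T) :
  connected E -> (forall i j, (i, j) \in E -> f i = f j) ->
  forall u v, f u = f v.
Proof.
move=> /connectedP cE fE u v.
have [p + ->] := connectP (cE u v).
elim: p u => //= w p IH u /andP[/orP[uw | wu] pw].
  by rewrite (fE _ _ uw) (IH _ pw).
by rewrite -(fE _ _ wu) (IH _ pw).
Qed.

Lemma connected_incident {d : nat} {E : {set 'I_d * 'I_d}} {u v : 'I_d} :
  connected E -> u != v -> exists w, adjacent E u w.
Proof.
move=> /connectedP cE uv.
have [[|w p] /=] := connectP (cE u v); first by move=> _ vu; rewrite vu eqxx in uv.
by move=> /andP[uw _] _; exists w.
Qed.

(** An edge of a cycle is redundant for connectedness: the rest of the cycle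
    still joins its ends. Both orientations are removed, since either one may be
    the arc that makes the nodes adjacent. *)
Lemma connected_cycle_edge {d : nat} {E : {set 'I_d * 'I_d}} {u v w : 'I_d} {c} :
  connected E -> ucycle (adjacent E) [:: u, v, w & c] ->
  connected (E :\ (u, v) :\ (v, u)).
Proof.
set F := _ :\ (v, u) => /connectedP cE /andP[].
rewrite /cycle rcons_cons /= => /and3P[_ vw pw] /and3P[].
rewrite !inE !negb_or => /and3P[uv uw uc] /andP[vw' vc] _.
have adjF x y : adjacent E x y -> (x, y) != (u, v) -> (x, y) != (v, u) ->
    adjacent F x y.
  move=> + xuv xvu; rewrite /adjacent !inE xuv xvu /=.
  have -> : ((y, x) != (v, u)) by rewrite xpair_eqE andbC -xpair_eqE.
  by have -> : ((y, x) != (u, v)) by rewrite xpair_eqE andbC -xpair_eqE.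
(* No edge of the path [w, c, u] is the edge [uv]: [v] is not on it. *)
have cwu : connect (adjacent F) w u.
  apply/connectP; exists (rcons c u); last by rewrite last_rcons.
  elim: c w pw vw' uw vc uc {vw} => /= [|x c IH] w.
    rewrite andbT => wu vw uw _ _; rewrite andbT adjF // xpair_eqE.
      by rewrite [w == u]eq_sym (negbTE uw).
    by rewrite [w == v]eq_sym (negbTE vw).
  move=> /andP[wx pw] vw uw; rewrite !inE !negb_or => /andP[vx vc] /andP[ux uc].
  rewrite IH // andbT adjF // xpair_eqE.
    by rewrite [w == u]eq_sym (negbTE uw).
  by rewrite [w == v]eq_sym (negbTE vw).
have cvu : connect (adjacent F) v u.
  apply: connect_trans (connect1 _) cwu.
  by rewrite adjF // xpair_eqE ?negb_and 1?[v == u]eq_sym 1?[w == u]eq_sym ?uv ?uw ?orbT.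
have symF := sym_connect_sym (adjacent_sym F).
have adj_connected x y : adjacent E x y -> connect (adjacent F) x y.
  move=> xy; case: (eqVneq (x, y) (u, v)) => [[-> ->]|nuv]; first by rewrite symF.
  case: (eqVneq (x, y) (v, u)) => [[-> ->] //|nvu].
  by rewrite connect1 // adjF.
by apply/connectedP => x y; apply: connect_sub (cE x y) => ? ?; apply: adj_connected.
Qed.

(** An inclusion-minimal connected subset of [E] is a tree: by minimality, none
    of its edges lies on a cycle. *)
Lemma spanning_tree_exists {d : nat} {P N : {set 'I_d}} {E : {set 'I_d * 'I_d}} :
  E \subset setX P N -> connected E ->
  exists2 F : {set 'I_d * 'I_d}, F \subset E & spanning_tree P N F.
Proof.
move=> EPN cE; have [F minF FE] := minset_exists cE.
exists F => //; split; first exact: subset_trans EPN.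
  exact/connectedP/(minsetp minF).
case=> -[|u [|v [|w c]]] [cyc //= _].
have FeF := minsetinf minF (connected_cycle_edge (minsetp minF) cyc).
have /setP F'F : F :\ (u, v) :\ (v, u) = F.
  by apply: FeF; apply: subset_trans (subD1set _ _) (subD1set _ _).
case/andP: cyc => /andP[+ _] _.
by rewrite /adjacent -!F'F !inE !eqxx /= andbF.
Qed.

(** * Bipartite connectedness of a preorder *)

(** Minimality is meant for a preorder: what lies below [i] is equivalent to
    [i]. *)
Definition minimal_nodes {d : nat} (A : {set 'I_d * 'I_d}) : {set 'I_d} :=
  [set i | [forall k, ((k, i) \in A) ==> ((i, k) \in A)]].

Section Preorder.

Context {d : nat} {A : {set 'I_d * 'I_d}}.
Hypothesis A_refl : forall i, (i, i) \in A.
Hypothesis A_trans : forall i k j, (i, k) \in A -> (k, j) \in A -> (i, j) \in A.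

Lemma minimal_nodesP i :
  reflect (forall k, (k, i) \in A -> (i, k) \in A) (i \in minimal_nodes A).
Proof.
by rewrite inE; apply: (iffP forallP) => H k; apply/implyP/(H k).
Qed.

(** Among the nodes below [x], one with the fewest nodes below it is minimal. *)
Lemma minimal_below x : exists2 m, m \in minimal_nodes A & (m, x) \in A.
Proof.
case: (@arg_minnP _ x [pred m | (m, x) \in A] (fun m => #|[set k | (k, m) \in A]|)).
  exact: A_refl.
move=> m /= mx min_m; exists m => //; apply/minimal_nodesP => k km.
have sub : [set l | (l, k) \in A] \subset [set l | (l, m) \in A].
  by apply/subsetP => l; rewrite !inE => /A_trans; apply.
have /setP/(_ m) : [set l | (l, k) \in A] = [set l | (l, m) \in A].
  by apply/eqP; rewrite eqEcard sub min_m //; apply: A_trans mx.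
by rewrite !inE A_refl.
Qed.

Hypothesis A_connected : connected A.
Hypothesis A_proper : exists i j, (i, j) \notin A.

(** If all nodes were minimal, the preorder would be symmetric; being above [i]
    would then be constant on connected components, and every pair would be
    related. *)
Lemma nonminimal_exists : exists n, n \notin minimal_nodes A.
Proof.
have [i [j ij]] := A_proper; apply/existsP; apply: contraR ij.
rewrite negb_exists => /forallP allmin.
suff <- : ((i, i) \in A) = ((i, j) \in A) by apply: A_refl.
apply: (connected_invariant (fun x => (i, x) \in A) A_connected) => x y xy.
apply/idP/idP => [/A_trans|ix]; first exact.
have /negPn/minimal_nodesP/(_ _ xy) := allmin y.
exact: A_trans.
Qed.

(** If everything above [p] were minimal, the up-set of [p] would be closed
    under arcs in both directions, hence would contain all nodes, including a
    nonminimal one. *)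
Lemma nonminimal_above {p} : p \in minimal_nodes A ->
  exists2 n, n \notin minimal_nodes A & (p, n) \in A.
Proof.
move=> pP; apply/exists_inP; apply: contraT => /exists_inPn noN.
have [n nN] := nonminimal_exists.
apply: contraNT (noN n nN) => _.
suff <- : ((p, p) \in A) = ((p, n) \in A) by apply: A_refl.
apply: (connected_invariant (fun x => (p, x) \in A) A_connected) => x y xy.
apply/idP/idP => [/A_trans|py]; first exact.
have /minimal_nodesP/(_ _ xy) : y \in minimal_nodes A.
  by apply/negPn/negP => /noN; rewrite py.
exact: A_trans.
Qed.

Lemma minimal_bipartition : bipartition (minimal_nodes A) (~: minimal_nodes A).
Proof.
have [n nN] := nonminimal_exists; have [p pP _] := minimal_below n.
split; first by apply/set0Pn; exists p.
- by apply/set0Pn; exists n; rewrite inE.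
- by rewrite -setI_eq0 setICr.
- exact: setUCr.
Qed.

(** An arc between two minimal nodes is bypassed through a nonminimal node above
    both, and an arc between two nonminimal nodes through a minimal node below
    both. No arc enters a minimal node from a nonminimal one. *)
Lemma bipartite_connected :
  connected (A :&: setX (minimal_nodes A) (~: minimal_nodes A)).
Proof.
set B := A :&: _.
have symB := sym_connect_sym (adjacent_sym B).
have BP p n : p \in minimal_nodes A -> n \notin minimal_nodes A ->
    (p, n) \in A -> connect (adjacent B) p n.
  move=> pP nN pn; apply: connect1; apply/orP; left.
  by rewrite inE pn in_setX pP in_setC nN.
have A_B x y : (x, y) \in A -> connect (adjacent B) x y.
  move=> xy; case: (boolP (y \in minimal_nodes A)) => yP.
    have xP : x \in minimal_nodes A.
      apply/minimal_nodesP => k kx; apply: (A_trans _ _ _ xy).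
      exact/(minimal_nodesP _ yP)/(A_trans _ _ _ kx xy).
    have [n nN yn] := nonminimal_above yP.
    apply: connect_trans (BP x n xP nN (A_trans _ _ _ xy yn)) _.
    by rewrite symB BP.
  case: (boolP (x \in minimal_nodes A)) => xP; first exact: BP.
  have [p pP px] := minimal_below x.
  apply: connect_trans _ (BP p y pP yP (A_trans _ _ _ px xy)).
  by rewrite symB BP.
apply/connectedP => x y; move/connectedP: A_connected => /(_ x y).
apply: connect_sub => u v /orP[/A_B //|/A_B]; by rewrite symB.
Qed.

End Preorder.

(** * The dual of the solvency cone *)

(** Finitely many strict inequalities survive a small perturbation. *)
Lemma small_multiplier {R : realFieldType} (I : finType) (a b : I -> R) :
  (forall i, 0 <= a i) -> (forall i, a i = 0 -> b i = 0) ->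
  exists2 e : R, 0 < e & forall i, e * `|b i| <= a i.
Proof.
move=> a0 ab; pose s := \sum_i `|b i| / a i.
have s_ge i : `|b i| / a i <= s.
  by rewrite /s (bigD1 i) //= lerDl sumr_ge0 // => j _; rewrite divr_ge0.
have s0 : 0 <= s by rewrite /s sumr_ge0 // => i _; rewrite divr_ge0.
have s1 : 0 < 1 + s by lra.
(* The summand 1 keeps the inverse positive when all terms of [s] vanish;
   terms with [a i = 0] contribute 0 because division by 0 is 0. *)
exists (1 + s)^-1 => [|i]; first by rewrite invr_gt0.
rewrite mulrC ler_pdivrMr //.
case: (eqVneq (a i) 0) => [ai|ai]; first by rewrite ab // ai normr0 mul0r.
rewrite mulrC -ler_pdivrMr; first by have := s_ge i; lra.
by rewrite lt_neqAle eq_sym ai a0.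
Qed.

Section DualCone.

Context {R : realType} {d : nat} {Pi : 'M[R]_d}.
Implicit Types y u v : 'cV[R]_d.

Local Notation dual := (dual_cone (solvency_cone Pi)).

(** The inequalities say that [y] is nonnegative on the generators of the
    solvency cone; each generator is reached by a matrix unit [z]. *)
Lemma dual_coneP y : dual y <-> forall i j, y j 0 <= Pi i j * y i 0.
Proof.
have pairing i j : ((Pi i j *: unit_vec R i - unit_vec R j)^T *m y) 0 0 =
    Pi i j * y i 0 - y j 0.
  have coord k : ((unit_vec R k)^T *m y) 0 0 = y k 0.
    by rewrite /unit_vec trmx_delta -rowE mxE.
  rewrite linearB /= linearZ /= mulmxBl -scalemxAl.
  by rewrite [LHS]mxE [in LHS]mxE [X in _ + X]mxE !coord.
split=> [dy i j | dy x [z [z0 ->]]].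
  rewrite -subr_ge0 -pairing; apply: dy.
  exists (delta_mx i j); split=> [a b|]; first by rewrite mxE ler0n.
  rewrite (bigD1 (i, j)) //= mxE !eqxx scale1r big1 ?addr0 // => -[a b] /= ab.
  by rewrite mxE -xpair_eqE (negbTE ab) scale0r.
rewrite linear_sum /= mulmx_suml summxE sumr_ge0 // => -[i j] _ /=.
by rewrite linearZ /= -scalemxAl mxE pairing mulr_ge0 // subr_ge0.
Qed.

Hypothesis Pi_diag : forall i, Pi i i = 1.
Hypothesis Pi_gt0 : forall i j, 0 < Pi i j.
Hypothesis Pi_tri : forall i j k, Pi i j <= Pi i k * Pi k j.
Hypothesis Pi_strict : exists i j k, Pi i j < Pi i k * Pi k j.

(** For a strict triple the cycle [i, k, j, i] has rate product [C > 1], and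
    [y i <= C * y i] forces [y i >= 0]. Every coordinate is bounded above by a
    positive multiple of every other one, so all are nonnegative, and a single
    zero makes all of them vanish. *)
Lemma dual_gt0 y : dual y -> y <> 0 -> forall i, 0 < y i 0.
Proof.
move=> /dual_coneP dy y0.
have [i [j [k ijk]]] := Pi_strict.
have cyc : 1 < Pi i k * Pi k j * Pi j i.
  rewrite -(Pi_diag i); apply: le_lt_trans (Pi_tri i i j) _.
  by rewrite ltr_pM2r.
have yi : 0 <= y i 0.
  have ji : y i 0 <= Pi i k * Pi k j * Pi j i * y i 0.
    have -> : Pi i k * Pi k j * Pi j i * y i 0 = Pi j i * (Pi k j * (Pi i k * y i 0)).
      by ring.
    apply: le_trans (dy j i) _; rewrite ler_pM2l //.
    by apply: le_trans (dy k j) _; rewrite ler_pM2l.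
  by rewrite -(pmulr_rge0 _ (_ : 0 < Pi i k * Pi k j * Pi j i - 1)) ?subr_gt0 //
     mulrBl mul1r subr_ge0.
have y_ge0 l : 0 <= y l 0.
  by rewrite -(pmulr_rge0 _ (Pi_gt0 l i)); exact: le_trans yi (dy l i).
move=> l; rewrite lt_neqAle y_ge0 andbT; apply/eqP => yl; apply: y0.
apply/matrixP => m c; rewrite ord1 mxE; apply/eqP.
by rewrite eq_le y_ge0 andbT; have := dy l m; rewrite -yl mulr0.
Qed.


(** * Tight constraints and extremality *)

Definition tight_arcs y : {set 'I_d * 'I_d} :=
  [set ij | Pi ij.1 ij.2 * y ij.1 0 == y ij.2 0].

Lemma tight_arcsP {y} {i j} :
  reflect (Pi i j * y i 0 = y j 0) ((i, j) \in tight_arcs y).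
Proof. by rewrite inE; apply: eqP. Qed.

Lemma tight_refl y i : (i, i) \in tight_arcs y.
Proof. by apply/tight_arcsP; rewrite Pi_diag mul1r. Qed.

(** Two consecutive tight arcs and the triangle inequality squeeze the third
    inequality into an equality. *)
Lemma tight_trans {y} : dual y -> (forall i, 0 < y i 0) ->
  forall i k j, (i, k) \in tight_arcs y -> (k, j) \in tight_arcs y ->
  (i, j) \in tight_arcs y.
Proof.
move=> /dual_coneP dy y0 i k j /tight_arcsP ik /tight_arcsP kj.
apply/tight_arcsP/eqP; rewrite eq_le dy andbT -kj -ik mulrA ler_pM2r //.
by rewrite [leRHS]mulrC.
Qed.

Lemma tight_proper {y} : (forall i, 0 < y i 0) ->
  exists i j, (i, j) \notin tight_arcs y.
Proof.
move=> y0; have [i [j [k]]] := Pi_strict.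
case: (boolP ((i, k) \in tight_arcs y)) => [/tight_arcsP ik|]; last by exists i, k.
case: (boolP ((k, j) \in tight_arcs y)) => [/tight_arcsP kj|]; last by exists k, j.
move=> lt; exists i, j; apply/tight_arcsP => ij; move: lt.
by rewrite -(ltr_pM2r (y0 i)) mulrAC ik ij mulrC kj ltxx.
Qed.

(** A constraint tight for [u + v] is tight for [u]; so [u i / y i] is constant
    along tight arcs, hence everywhere, which makes [u] a multiple of [y]. *)
Lemma tight_connected_extreme y :
  (0 < d)%N -> dual y -> (forall i, 0 < y i 0) -> connected (tight_arcs y) ->
  extreme_direction dual y.
Proof.
move=> d0 dy y0 cy; pose o := Ordinal d0.
split.
  by split=> // y_eq0; have := y0 o; rewrite y_eq0 mxE ltxx.
case=> u [v [[du u0] [dv _] not_uy _ yuv]]; apply: not_uy.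
have u_gt0 := dual_gt0 _ du u0.
have ratio i j : (i, j) \in tight_arcs y -> u i 0 / y i 0 = u j 0 / y j 0.
  move=> /tight_arcsP ij.
  have uj : Pi i j * u i 0 = u j 0.
    have := (dual_coneP u).1 du i j; have := (dual_coneP v).1 dv i j.
    by move: ij; rewrite yuv !mxE; lra.
  rewrite -uj -ij -mulf_div divff ?mul1r //; exact: lt0r_neq0.
exists (u o 0 / y o 0); first by rewrite divr_gt0.
apply/matrixP => i k; rewrite ord1 mxE.
rewrite (connected_invariant (fun i => u i 0 / y i 0) cy ratio o i) divfK //.
exact: lt0r_neq0.
Qed.

(** If [p] and [q] are not joined by tight arcs, let [w] be [y] restricted to
    the component [S] of [p]. Adding a multiple of [w] keeps every tight
    constraint tight, as its two nodes are scaled alike, and for a small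
    multiple the other constraints persist. So [y] is the sum of
    [y / 2 + e w] and [y / 2 - e w], which are not multiples of [y]: their ratio
    to [y] is [1 / 2 + e] or [1 / 2 - e] at [p] but [1 / 2] at [q]. *)
Lemma extreme_tight_connected y :
  (forall i, 0 < y i 0) -> extreme_direction dual y -> connected (tight_arcs y).
Proof.
move=> y0 [[/dual_coneP dy _] indec]; apply/connectedP => p q.
apply: contraT => npq; case: indec.
pose S i := connect (adjacent (tight_arcs y)) p i.
pose w : 'cV[R]_d := \col_i ((S i)%:R * y i 0).
pose slack (ij : 'I_d * 'I_d) := (Pi ij.1 ij.2 * y ij.1 0 - y ij.2 0) / 2.
pose change (ij : 'I_d * 'I_d) := Pi ij.1 ij.2 * w ij.1 0 - w ij.2 0.
have [||e e0 small] := small_multiplier _ slack change.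
- by move=> [i j]; rewrite /slack /=; have := dy i j; lra.
- move=> [i j]; rewrite /slack /change /= !mxE => ij_tight.
  have ij : Pi i j * y i 0 = y j 0 by lra.
  have -> : S i = S j.
    apply/idP/idP => /connect_trans; apply; apply: connect1; rewrite /adjacent.
      by apply/orP; left; apply/tight_arcsP.
    by apply/orP; right; apply/tight_arcsP.
  by rewrite mulrCA ij subrr.
have perturbed_dual t : `|t| = e -> dual (2^-1 *: y + t *: w).
  move=> te; apply/dual_coneP => i j; have := small (i, j).
  rewrite -te -normrM ler_norml /slack /change /= => /andP[lo _].
  have coord k : (2^-1 *: y + t *: w) k 0 = 2^-1 * y k 0 + t * w k 0.
    by rewrite !mxE.
  by rewrite !coord; lra.
have perturbed_dir t : `|t| = e -> is_direction dual (2^-1 *: y + t *: w) /\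
    ~ same_direction (2^-1 *: y + t *: w) y.
  move=> te; have Sp : S p by exact: connect0.
  have Sq : S q = false by exact/negbTE.
  have t0 : t != 0 by rewrite -normr_gt0 te.
  have atq : (2^-1 *: y + t *: w) q 0 = 2^-1 * y q 0.
    by rewrite !mxE Sq mul0r mulr0 addr0.
  split.
    split; first exact: perturbed_dual.
    by move=> /matrixP/(_ q 0); rewrite atq mxE; have := y0 q; lra.
  case=> c _ uy; move/matrixP: (uy) => /(_ p 0).
  rewrite !mxE Sp mul1r -mulrDl => /(mulIf (lt0r_neq0 (y0 p))) cp.
  move/matrixP: (uy) => /(_ q 0).
  rewrite atq mxE => /(mulIf (lt0r_neq0 (y0 q))) cq.
  by move/eqP: t0; apply; lra.
have [|du nu] := perturbed_dir e; first by rewrite gtr0_norm.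
have [|dv nv] := perturbed_dir (- e); first by rewrite normrN gtr0_norm.
exists (2^-1 *: y + e *: w), (2^-1 *: y + - e *: w); split => //.
apply/matrixP => i k; rewrite !mxE; lra.
Qed.

(** * Feasible tree solutions *)

Lemma bipartition_neq {P N : {set 'I_d}} {p n} :
  bipartition P N -> p \in P -> n \in N -> p != n.
Proof.
case=> _ _ PN _ pP nN; apply/eqP => pn.
by rewrite -pn (disjointFr PN pP) in nN.
Qed.

Lemma feasible_gt0 {P N y} : bipartition P N -> feasible Pi P N y ->
  forall i, 0 < y i 0.
Proof.
case=> /set0Pn[p pP] /set0Pn[n nN] _ PN fy i.
have : i \in P :|: N by rewrite PN inE.
case/setUP => iX; last by case: (fy p i pP iX).
by have [yn n0] := fy i n iX nN; rewrite -(pmulr_rgt0 _ (Pi_gt0 i n)) (lt_le_trans n0).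
Qed.

(** The case distinction on the sides of [i] and [j] is avoided by allowing
    [a = i] when [i] is in [P] and [b = j] when [j] is in [N], the loops being
    tight because the diagonal rates are 1. *)
Lemma feasible_dual {P N E y} : bipartition P N -> feasible Pi P N y ->
  connected E -> E \subset setX P N -> E \subset tight_arcs y -> dual y.
Proof.
move=> bPN fy cE /subsetP EPN /subsetP Et.
have [/set0Pn[p pP] /set0Pn[n nN] _ PN] := bPN.
have side i : (i \in P) || (i \in N) by rewrite -in_setU PN inE.
have tail i : exists2 a, a \in P & Pi a i * y a 0 = y i 0.
  have [iP|iN] := orP (side i); first by exists i; rewrite ?Pi_diag ?mul1r.
  have ip : i != p by rewrite eq_sym (bipartition_neq bPN).
  have [a /orP[ia|ai]] := connected_incident cE ip.
    have /setXP[iP _] := EPN _ ia.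
    by have := bipartition_neq bPN iP iN; rewrite eqxx.
  by exists a; [have /setXP[] := EPN _ ai | apply/tight_arcsP/Et].
have head j : exists2 b, b \in N & Pi j b * y j 0 = y b 0.
  have [jP|jN] := orP (side j); last by exists j; rewrite ?Pi_diag ?mul1r.
  have jn : j != n := bipartition_neq bPN jP nN.
  have [b /orP[jb|bj]] := connected_incident cE jn.
    by exists b; [have /setXP[] := EPN _ jb | apply/tight_arcsP/Et].
  have /setXP[_ jN] := EPN _ bj.
  by have := bipartition_neq bPN jP jN; rewrite eqxx.
apply/dual_coneP => i j.
have [a aP ai] := tail i; have [b bN jb] := head j.
rewrite -(ler_pM2l (Pi_gt0 j b)) jb -ai.
apply: le_trans (fy a b aP bN).1 _.
have ya := feasible_gt0 bPN fy a.
rewrite !mulrA ler_pM2r //; apply: le_trans (Pi_tri a b i) _.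
rewrite [leRHS](_ : _ = Pi a i * (Pi i j * Pi j b)); last by ring.
by rewrite ler_pM2l.
Qed.

End DualCone.

Theorem theorem6 (R : realType) (d : nat) (hd : (2 <= d)%N) (Pi : 'M[R]_d)
    (Pi_diag : forall i : 'I_d, Pi i i = 1)
    (Pi_gt0 : forall i j : 'I_d, 0 < Pi i j)
    (Pi_tri : forall i j k : 'I_d, Pi i j <= Pi i k * Pi k j)
    (Pi_strict : exists i j k : 'I_d, Pi i j < Pi i k * Pi k j)
    (y : 'cV[R]_d) :
  extreme_direction (dual_cone (solvency_cone Pi)) y <->
  (exists P N : {set 'I_d},
     bipartition P N /\ feasible_tree_solution Pi P N y).
Proof.
split=> [ext | [P [N [bPN [fy [E [[EPN cE _] Egen]]]]]]].
  have [[dy y_neq0] _] := ext.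
  have y0 := dual_gt0 Pi_diag Pi_gt0 Pi_tri Pi_strict y dy y_neq0.
  have tr := tight_refl Pi_diag y.
  have tt := tight_trans Pi_tri dy y0.
  have tc := extreme_tight_connected y y0 ext.
  have tp := tight_proper Pi_strict y0.
  have [F /subsetP FE treeF] :=
    spanning_tree_exists (subsetIr _ _) (bipartite_connected tr tt tc tp).
  pose P := minimal_nodes (tight_arcs (Pi := Pi) y); exists P, (~: P).
  split; first exact: minimal_bipartition.
  split; first by move=> i j _ _; split => //; apply: (dual_coneP y).1.
  exists F; split=> // i j /FE /setIP[/tight_arcsP ij _]; by split.
have y0 := feasible_gt0 Pi_gt0 bPN fy.
have Et : E \subset tight_arcs (Pi := Pi) y.
  by apply/subsetP => -[i j] /Egen[ij _]; apply/tight_arcsP.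
have {}cE : connected E by apply/connectedP.
have dy := feasible_dual Pi_diag Pi_gt0 Pi_tri bPN fy cE EPN Et.
apply: tight_connected_extreme => //; first exact: ltn_trans hd.
apply/connectedP => u v; move/connectedP: cE => /(_ u v); apply: connect_sub => a b ab.
apply: connect1; case/orP: ab => /(subsetP Et) ab; apply/orP; by [left | right].
Qed.
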